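(* Let $\mathbb{A}=(A_1,\dots,A_m)\in\mathbb{P}_n^m$ and $\omega=(w_1,\dots,w_m)\in\Delta_m$. Then for every $X\in\Gamma(\omega;\mathbb{A})$, $$\exp\Bigl(\sum_{i=1}^m w_i\log A_i\Bigr)\prec_{\log}X.$$
   Context: $\mathbb{P}_n$ is the set of $n\times n$ complex positive definite matrices; $\Delta_m$ is the set of $\omega=(w_1,\dots,w_m)$ with $w_i>0$ and $\sum_i w_i=1$. $A\sharp B=A^{1/2}(A^{-1/2}BA^{-1/2})^{1/2}A^{1/2}$. The Karcher mean $\Lambda(\omega;A_1,\dots,A_m)$ is the unique $X\in\mathbb{P}_n$ with $\sum_i w_i\log(X^{-1/2}A_iX^{-1/2})=0$. Define $$\Gamma(\omega;\mathbb{A})=\{X\in\mathbb{P}_n:\Lambda(\omega;A_1\sharp X^{-1},\dots,A_m\sharp X^{-1})=I\},$$ equivalently the set of $X\in\mathbb{P}_n$ with $\sum_i w_i\log(A_i\sharp X^{-1})=0$. For $A,B\in\mathbb{P}_n$ with eigenvalues in decreasing order $\lambda_1\ge\dots\ge\lambda_n$, log-majorization $A\prec_{\log}B$ means $\prod_{j=1}^k\lambda_j(A)\le\prod_{j=1}^k\lambda_j(B)$ for $1\le k\le n$, with equality for $k=n$ (i.e. $\det A=\det B$). *)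

(* Defs.v *)
From HB Require Import structures.
From mathcomp Require Import all_boot all_order all_algebra.
From mathcomp Require Import spectral sesquilinear complex.
From mathcomp Require Import boolp classical_sets reals sequences exp.

Set Implicit Arguments.
Unset Strict Implicit.
Unset Printing Implicit Defensive.

Import Order.TTheory GRing.Theory Num.Theory.
Local Open Scope ring_scope.
Local Open Scope sesquilinear_scope.
Local Open Scope complex_scope.
Local Open Scope classical_set_scope.

Section Matrices.
Variables (R : realType) (n : nat).
Implicit Types (A B X : 'M[R[i]]_n).

(* The order on R[i] makes [0 < z] mean that z is real and positive. *)
Definition posdefmx A : Prop :=
  A \is hermsymmx /\
  forall x : 'cV[R[i]]_n, x != 0 -> 0 < (x ^t* *m A *m x) 0 0.

(* Functional calculus; meaningful for Hermitian A only, whose eigenvalues,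
   listed by [spectral_diag A], are real.  By [spectral_funmxE] the result does
   not depend on the chosen unitary diagonalization. *)
Definition spectral_funmx (f : R -> R) A : 'M[R[i]]_n :=
  invmx (spectralmx A)
    *m diag_mx (map_mx (fun z => (f (complex.Re z))%:C) (spectral_diag A))
    *m spectralmx A.

Definition sqrtmx A := spectral_funmx Num.sqrt A.
Definition logmx A := spectral_funmx (@ln R) A.
Definition expmx A := spectral_funmx expR A.

Definition geomean A B : 'M[R[i]]_n :=
  sqrtmx A *m sqrtmx (invmx (sqrtmx A) *m B *m invmx (sqrtmx A)) *m sqrtmx A.

(* Decreasing, with multiplicity (see [char_poly_eigenvalues]); for Hermitian A
   only. *)
Definition eigenvalues A : seq R :=
  sort >=%O [seq complex.Re (spectral_diag A 0 j) | j <- enum 'I_n].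

Definition log_majorized A B : Prop :=
  (forall k, (1 <= k <= n)%N ->
     \prod_(j < k) (eigenvalues A)`_j <= \prod_(j < k) (eigenvalues B)`_j) /\
  \prod_(j < n) (eigenvalues A)`_j = \prod_(j < n) (eigenvalues B)`_j.

Section Means.
Variables (m : nat) (w : 'I_m -> R) (A : 'I_m -> 'M[R[i]]_n).

Definition karcher_eq X : Prop :=
  \sum_(i < m)
     (w i)%:C *: logmx (invmx (sqrtmx X) *m A i *m invmx (sqrtmx X)) = 0.

(* The Karcher equation has exactly one positive definite solution when w is a
   weight vector and all A i are positive definite; 0 is a junk value. *)
Definition karcher_mean : 'M[R[i]]_n :=
  xget 0 [set X | posdefmx X /\ karcher_eq X].

End Means.

Definition Gamma m (w : 'I_m -> R) (A : 'I_m -> 'M[R[i]]_n) :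
    set 'M[R[i]]_n :=
  [set X | posdefmx X /\
           karcher_mean w (fun i => geomean (A i) (invmx X)) = 1%:M].

Lemma spectral_funmxE (f : R -> R) A (P : 'M[R[i]]_n) (d : 'rV[R]_n) :
  P \is unitarymx -> A = P ^t* *m diag_mx (map_mx (real_complex R) d) *m P ->
  spectral_funmx f A = P ^t* *m diag_mx (map_mx (fun t => (f t)%:C) d) *m P.
Proof.
move=> Pu AE; pose Q := spectralmx A; pose e := spectral_diag A.
have Qu : Q \is unitarymx by apply: spectral_unitarymx.
have PV := unitarymxP Pu; have QV := unitarymxP Qu.
have PV' : P ^t* *m P = 1%:M by apply: mulmx1C.
have QV' : Q ^t* *m Q = 1%:M by apply: mulmx1C.
have AQ : A = Q ^t* *m diag_mx e *m Q.
  have /orthomx_spectralP : A \is normalmx.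
    apply/normalmxP; rewrite AE; set D := diag_mx _.
    have DC : D *m D ^t* = D ^t* *m D.
      by rewrite /D tr_diag_mx map_diag_mx diag_mxC.
    move: (D) DC => E EC; rewrite !trmx_mul !map_mxM /= trmxCK.
    rewrite !mulmxA -[_ *m P *m P ^t*]mulmxA -[_ *m P *m P ^t*]mulmxA.
    by rewrite !PV !mulmx1 -![P ^t* *m _ *m _]mulmxA EC.
  by rewrite (invmx_unitary Qu).
pose U := Q *m P ^t*.
have UE : U *m diag_mx (map_mx (real_complex R) d) = diag_mx e *m U.
  transitivity (Q *m A *m P ^t*).
    by rewrite {1}AE /U -!mulmxA PV mulmx1.
  by rewrite AQ /U !mulmxA QV mul1mx.
have fU : U *m diag_mx (map_mx (fun t => (f t)%:C) d)
          = diag_mx (map_mx (fun z => (f (complex.Re z))%:C) e) *m U.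
  apply/matrixP => i j; move/matrixP: UE => /(_ i j).
  rewrite !mul_mx_diag !mul_diag_mx; move: (U) => V; rewrite !mxE ![_ * V i j]mulrC.
  have [->|Unz] := eqVneq (V i j) 0; first by rewrite !mul0r.
  by move=> /(mulfI Unz) <-.
rewrite /spectral_funmx -/Q -/e (invmx_unitary Qu).
transitivity (Q ^t* *m (U *m diag_mx (map_mx (fun t => (f t)%:C) d)) *m P).
  by rewrite fU /U -!mulmxA PV' mulmx1.
by rewrite /U !mulmxA QV' mul1mx.
Qed.

Lemma char_poly_eigenvalues A : A \is hermsymmx ->
  char_poly A = \prod_(x <- eigenvalues A) ('X - (x%:C)%:P).
Proof.
move=> Ah; have Areal := hermitian_spectral_diag_real Ah.
have AE := orthomx_spectralP (hermitian_normalmx Ah).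
set S := spectralmx A in AE; have Su : S \in unitmx by apply: spectral_unit.
have -> : char_poly A = char_poly (diag_mx (spectral_diag A)).
  pose T := map_mx polyC S; pose V := map_mx polyC (invmx S).
  have VT : V *m T = 1%:M by rewrite -map_mxM mulVmx// map_mx1.
  rewrite /char_poly.
  have -> : char_poly_mx A = V *m char_poly_mx (diag_mx (spectral_diag A)) *m T.
    rewrite /char_poly_mx mulmxBr mulmxBl {1}AE !map_mxM; congr (_ - _).
    by rewrite mul_mx_scalar -scalemxAl VT scalemx1.
  by rewrite !det_mulmx mulrAC -det_mulmx VT det1 mul1r.
rewrite char_poly_trig ?diag_mx_is_trig// /eigenvalues.
rewrite (perm_big _ (permEl (perm_sort _ _))) big_map big_enum /=.
apply: eq_bigr => j _; rewrite !mxE eqxx mulr1n RRe_real//.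
by move/mxOverP: Areal; apply.
Qed.

End Matrices.

(* Main.v *)
Require Import Defs.
From mathcomp Require Import all_boot all_order all_algebra.
From mathcomp Require Import spectral sesquilinear complex.
From mathcomp Require Import classical_sets reals sequences exp.
From mathcomp Require Import ring lra.

(** The defining equation of Gamma says that the matrices [Y i], the geometric
means of [A i] and [X^-1], satisfy [sum_i w_i log (Y i) = 0].  Since [Y i]
solves the Riccati equation [Y X Y = A], every [A i] is the congruence
[Y i X Y i] of [X] ([Gamma_riccati]).

If [X <= c], then [A i <= c (Y i)^2], and operator monotonicity of the logarithm
([log_monotone]) gives [log (A i) <= ln c + 2 log (Y i)]; averaging kills the
logarithms of the [Y i], so [H := sum_i w_i log (A i)] is at most [ln c].  With
[c] the top eigenvalue of [X] this is the majorization inequality for [k = 1].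

For general [k], exterior powers can be avoided by a truncation.  Let [r] be the
[k]-th eigenvalue of [X] and [X' := max (X, r)] in the functional calculus, so
that [X <= X'] and [r <= X'].  With [B i := Y i X' Y i], monotonicity of the
logarithm gives both [log (A i) <= log (B i)] and
[D i := log (B i) - log (r (Y i)^2) >= 0].  Averaging,
[H <= D + ln r] where [D := sum_i w_i D i] is positive semidefinite.
Compressing to the top [k] eigenvectors of [H] and using that a partial trace of
[D] is at most its full trace ([sum_eigenvalues_le]), the sum of the [k] largest
eigenvalues of [H] is at most [tr D + k ln r].  Finally
[tr D = ln det X' - n ln r] because the trace of a logarithm is the logarithm of
the determinant, and this is the sum of [ln lambda_j(X) - ln r] over [j <= k]:
all later eigenvalues were truncated to [r].  So the bound is exactly the sum of
the [ln lambda_j(X)] for [j <= k].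

The equality of determinants is the trace of the averaged identity
[tr log (A i) = 2 tr log (Y i) + tr log X] ([trace_weighted_log]). *)

Set Implicit Arguments.
Unset Strict Implicit.
Unset Printing Implicit Defensive.

Import Order.TTheory GRing.Theory Num.Theory.
Local Open Scope ring_scope.
Local Open Scope complex_scope.

(** * Spectral functional calculus *)

Section SpectralCalculus.
Local Open Scope sesquilinear_scope.
Context {R : realType} {n : nat}.
Implicit Types (A B C D S T X Y Z : 'M[R[i]]_n) (f g : R -> R).

(** Only the values of the quadratic form are constrained: [0 <= z] in [R[i]]
already says that [z] is real.  The Loewner order between [A] and [B] is
[psdmx (B - A)]. *)
Definition psdmx A := forall v : 'cV[R[i]]_n, 0 <= (v ^t* *m A *m v) 0 0.

(** Real parts, so that real functions apply; no information is lost for the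
Hermitian matrices considered here. *)
Definition spectrum A : 'rV[R]_n := map_mx (@complex.Re R) (spectral_diag A).

Lemma trmxC_mul p q r (A : 'M[R[i]]_(p, q)) (B : 'M[R[i]]_(q, r)) :
  (A *m B) ^t* = B ^t* *m A ^t*.
Proof. by rewrite trmx_mul map_mxM. Qed.

Lemma hermsymP A : A \is hermsymmx <-> A ^t* = A.
Proof.
split; first by move=> /is_hermitianmxP; rewrite expr0 scale1r => {2}->.
by move=> h; apply/is_hermitianmxP; rewrite expr0 scale1r h.
Qed.

Lemma spectralK A : spectralmx A *m (spectralmx A) ^t* = 1%:M.
Proof. exact/unitarymxP/spectral_unitarymx. Qed.

Lemma spectralVK A : (spectralmx A) ^t* *m spectralmx A = 1%:M.
Proof. exact: mulmx1C (spectralK A). Qed.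

Lemma eq_diag (P Q : 'M[R[i]]_n) (d e : 'rV[R[i]]_n) :
  d = e -> P *m diag_mx d *m Q = P *m diag_mx e *m Q.
Proof. by move=> ->. Qed.

Lemma spectral_funE f A : spectral_funmx f A =
  (spectralmx A) ^t* *m diag_mx (map_mx (fun t => (f t)%:C) (spectrum A))
    *m spectralmx A.
Proof.
rewrite /spectral_funmx (invmx_unitary (spectral_unitarymx A)) -map_mx_comp.
by apply: eq_diag; apply/rowP => j; rewrite !mxE.
Qed.

Lemma spectral_fun_id A : A \is hermsymmx -> spectral_funmx id A = A.
Proof.
move=> Ah; have Areal := hermitian_spectral_diag_real Ah.
rewrite [RHS](orthomx_spectralP (hermitian_normalmx Ah)) /spectral_funmx.
apply: eq_diag; apply/matrixP => i j.
by rewrite ord1 !mxE RRe_real//; move/mxOverP: Areal; apply.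
Qed.

Lemma spectral_fun_comp f g A :
  spectral_funmx g (spectral_funmx f A) = spectral_funmx (g \o f) A.
Proof.
rewrite [RHS]spectral_funE.
rewrite (@spectral_funmxE _ _ g _ (spectralmx A) (map_mx f (spectrum A))).
- by apply: eq_diag; apply/rowP => j; rewrite !mxE.
- exact: spectral_unitarymx.
rewrite spectral_funE.
by apply: eq_diag; apply/rowP => j; rewrite !mxE.
Qed.

Lemma eq_spectral_fun f g A : (forall j, f (spectrum A 0 j) = g (spectrum A 0 j)) ->
  spectral_funmx f A = spectral_funmx g A.
Proof.
move=> fg; rewrite !spectral_funE; apply: eq_diag.
by apply/rowP => j; rewrite !mxE; move: (fg j); rewrite mxE => ->.
Qed.

Lemma spectral_funM f g A :
  spectral_funmx (fun t => f t * g t) A = spectral_funmx f A *m spectral_funmx g A.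
Proof.
rewrite !spectral_funE -[RHS]mulmxA !(mulmxA (spectralmx A)) spectralK mul1mx.
rewrite mulmxA -[X in _ = X *m _]mulmxA mulmx_diag; apply: eq_diag.
by apply/rowP => j; rewrite !mxE rmorphM.
Qed.

Lemma spectral_funD f g A :
  spectral_funmx (fun t => f t + g t) A = spectral_funmx f A + spectral_funmx g A.
Proof.
rewrite !spectral_funE -mulmxDl -mulmxDr -raddfD; apply: eq_diag.
by apply/rowP => j; rewrite !mxE rmorphD.
Qed.

Lemma spectral_funB f g A :
  spectral_funmx (fun t => f t - g t) A = spectral_funmx f A - spectral_funmx g A.
Proof.
rewrite !spectral_funE -mulmxBl -mulmxBr -raddfB; apply: eq_diag.
by apply/rowP => j; rewrite !mxE rmorphB.
Qed.

Lemma spectral_fun_cst (c : R) A : spectral_funmx (fun=> c) A = c%:C%:M.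
Proof.
rewrite spectral_funE (_ : diag_mx _ = c%:C%:M).
  by rewrite mul_mx_scalar -scalemxAl spectralVK scalemx1.
by apply/matrixP => i j; rewrite !mxE.
Qed.

Lemma spectral_funZ (c : R) f A :
  spectral_funmx (fun t => c * f t) A = c%:C *: spectral_funmx f A.
Proof. by rewrite spectral_funM spectral_fun_cst mul_scalar_mx. Qed.

Lemma spectral_fun_herm f A : spectral_funmx f A \is hermsymmx.
Proof.
apply/hermsymP; rewrite spectral_funE !trmxC_mul trmxCK mulmxA.
rewrite tr_diag_mx map_diag_mx; apply: eq_diag.
by apply/rowP => j; rewrite !mxE; exact: conjc_real.
Qed.

Lemma trace_spectral_fun f A :
  \tr (spectral_funmx f A) = (\sum_j f (spectrum A 0 j))%:C.
Proof.
rewrite spectral_funE mxtrace_mulC mulmxA spectralK mul1mx mxtrace_diag.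
by rewrite rmorph_sum; apply: eq_bigr => j _; rewrite !mxE.
Qed.

Lemma det_spectral_fun f A :
  \det (spectral_funmx f A) = (\prod_j f (spectrum A 0 j))%:C.
Proof.
rewrite spectral_funE !det_mulmx mulrAC -det_mulmx spectralVK det1 mul1r.
by rewrite det_diag rmorph_prod; apply: eq_bigr => j _; rewrite !mxE.
Qed.

Lemma qform_spectral_fun f A (v : 'cV[R[i]]_n) :
  (v ^t* *m spectral_funmx f A *m v) 0 0 =
  \sum_j (f (spectrum A 0 j))%:C * `|(spectralmx A *m v) j 0| ^+ 2.
Proof.
rewrite spectral_funE !mulmxA -trmxC_mul -mulmxA.
set u := spectralmx A *m v; rewrite mul_mx_diag mxE; apply: eq_bigr => j _.
by rewrite !mxE normCK mulrAC mulrC; congr (_ * _); rewrite mulrC.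
Qed.

Lemma qformD (v : 'cV[R[i]]_n) A B : (v ^t* *m (A + B) *m v) 0 0 =
  (v ^t* *m A *m v) 0 0 + (v ^t* *m B *m v) 0 0.
Proof. by rewrite mulmxDr mulmxDl [LHS]mxE. Qed.

Lemma qformB (v : 'cV[R[i]]_n) A B : (v ^t* *m (A - B) *m v) 0 0 =
  (v ^t* *m A *m v) 0 0 - (v ^t* *m B *m v) 0 0.
Proof. by rewrite qformD mulmxN mulNmx [X in _ + X]mxE. Qed.

Definition eigvec A j : 'cV[R[i]]_n := (spectralmx A) ^t* *m delta_mx j 0.

Lemma spectral_eigvec A j : spectralmx A *m eigvec A j = delta_mx j 0.
Proof. by rewrite mulmxA spectralK mul1mx. Qed.

Lemma eigvec_neq0 A j : eigvec A j != 0.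
Proof.
apply/eqP => h; have := spectral_eigvec A j; rewrite h mulmx0.
by move/matrixP/(_ j 0); rewrite !mxE !eqxx => /esym/eqP; rewrite oner_eq0.
Qed.

Lemma spectral_fun_eigvec f A j :
  spectral_funmx f A *m eigvec A j = (f (spectrum A 0 j))%:C *: eigvec A j.
Proof.
rewrite spectral_funE -!mulmxA spectral_eigvec scalemxAr.
congr (_ *m _); apply/matrixP => i k; rewrite ord1 mul_diag_mx !mxE.
by have [->|] := eqVneq i j; rewrite ?mulr0.
Qed.

Lemma qform_eigvec f A j :
  ((eigvec A j) ^t* *m spectral_funmx f A *m eigvec A j) 0 0 =
  (f (spectrum A 0 j))%:C.
Proof.
rewrite qform_spectral_fun spectral_eigvec (bigD1 j)//= big1 ?addr0.
  by rewrite [delta_mx _ _ _ _]mxE !eqxx normr1 expr1n mulr1.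
by move=> k kj; rewrite [delta_mx _ _ _ _]mxE (negPf kj) normr0 expr0n mulr0.
Qed.

(** The trace of [D] may be read off in the eigenbasis of another matrix [A];
this is what compares a partial trace along [A] with the full trace. *)
Lemma trace_eigvec D A : \tr D = \sum_j ((eigvec A j) ^t* *m D *m eigvec A j) 0 0.
Proof.
rewrite -[D in LHS]mulmx1 -(spectralVK A) mulmxA mxtrace_mulC mulmxA.
apply: eq_bigr => j _; rewrite trmxC_mul trmxCK -!mulmxA.
rewrite (_ : (delta_mx j 0) ^t* = delta_mx 0 j).
  by rewrite -rowE !mulmxA mxE -colE !mxE.
by rewrite trmx_delta; apply/matrixP => i k; rewrite !mxE; case: (_ && _); rewrite ?conjC1 ?conjC0.
Qed.

Lemma posdef_spectrum A : posdefmx A -> forall j, 0 < spectrum A 0 j.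
Proof.
case=> Ah Ap j; have := Ap _ (eigvec_neq0 A j).
by rewrite -{2}(spectral_fun_id Ah) qform_eigvec ltcR.
Qed.

Lemma posdef_spectral_fun f A :
  (forall j, 0 < f (spectrum A 0 j)) -> posdefmx (spectral_funmx f A).
Proof.
move=> f0; split; first exact: spectral_fun_herm.
move=> v v0; rewrite qform_spectral_fun.
have [j uj] : exists j, (spectralmx A *m v) j 0 != 0.
  apply/existsP; apply: contraNT v0 => /existsPn h.
  rewrite -[v]mul1mx -(spectralVK A) -mulmxA (_ : _ *m v = 0) ?mulmx0//.
  by apply/matrixP => i k; rewrite ord1 [RHS]mxE; apply/eqP; rewrite -[_ == _]negbK h.
rewrite (bigD1 j)//= ltr_pwDl//.
  by rewrite mulr_gt0 ?ltcR ?exprn_gt0 ?normr_gt0.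
by apply: sumr_ge0 => k _; rewrite mulr_ge0 ?lecR ?exprn_ge0 ?normr_ge0 ?(ltW (f0 _)).
Qed.

Lemma posdef_unit A : posdefmx A -> A \in unitmx.
Proof.
move=> Ap; rewrite unitmxE unitfE -(spectral_fun_id (proj1 Ap)).
rewrite det_spectral_fun gt_eqF// ltcR prodr_gt0// => j _.
exact: posdef_spectrum.
Qed.

(** * Congruences and the Loewner order *)

Lemma posdef_sandwich Y Z : posdefmx Y -> posdefmx Z -> posdefmx (Y *m Z *m Y).
Proof.
move=> Yp [/hermsymP Zh Zp]; have Yh := (hermsymP Y).1 Yp.1; split.
  by apply/hermsymP; rewrite !trmxC_mul Yh Zh mulmxA.
move=> v v0; rewrite -{1}Yh !mulmxA -trmxC_mul -mulmxA; apply: Zp.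
apply: contraNneq v0 => Yv.
by rewrite -[v]mul1mx -(mulVmx (posdef_unit Yp)) -mulmxA Yv mulmx0.
Qed.

Lemma psd_sandwichB Y Z T : posdefmx Y -> psdmx (T - Z) ->
  psdmx (Y *m T *m Y - Y *m Z *m Y).
Proof.
move=> Yp TZ v; have -> : Y *m T *m Y - Y *m Z *m Y = Y *m (T - Z) *m Y.
  by rewrite mulmxBr mulmxBl.
by rewrite -{1}((hermsymP Y).1 Yp.1) !mulmxA -trmxC_mul -mulmxA; apply: TZ.
Qed.

Lemma psdD A B : psdmx A -> psdmx B -> psdmx (A + B).
Proof. by move=> Ap Bp v; rewrite qformD addr_ge0. Qed.

Lemma psdZ (c : R) A : 0 <= c -> psdmx A -> psdmx (c%:C *: A).
Proof.
by move=> c0 Ap v; rewrite -scalemxAr -scalemxAl mxE mulr_ge0// ler0c.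
Qed.

Lemma psd_sum (I : finType) (F : I -> 'M[R[i]]_n) :
  (forall i, psdmx (F i)) -> psdmx (\sum_i F i).
Proof.
move=> Fp; apply: (@big_ind _ psdmx) => [v||i _]; last exact: Fp.
  by rewrite mulmx0 mul0mx mxE.
exact: psdD.
Qed.

Lemma psd_spectral_fun f A :
  (forall j, 0 <= f (spectrum A 0 j)) -> psdmx (spectral_funmx f A).
Proof.
move=> f0 v; rewrite qform_spectral_fun; apply: sumr_ge0 => j _.
by rewrite mulr_ge0 ?lecR ?exprn_ge0.
Qed.

(** Let [D := T - S] and [D v = l v].  Since [T^2 - S^2 = T D + D S], evaluating
the quadratic form at [v] gives [l (v^* T v + v^* S v) >= 0], and the second
factor is positive; hence every eigenvalue [l] of [D] is nonnegative. *)
Lemma sqrt_monotone S T : posdefmx S -> posdefmx T ->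
  psdmx (T *m T - S *m S) -> psdmx (T - S).
Proof.
move=> [Sh Sp] [Th Tp] ST; set D := T - S.
have Dh : D \is hermsymmx.
  by apply/hermsymP; rewrite linearB /= map_mxB (hermsymP T).1// (hermsymP S).1.
rewrite -(spectral_fun_id Dh); apply: psd_spectral_fun => j.
set l := spectrum D 0 j; set v := eigvec D j.
have Dv : D *m v = l%:C *: v by rewrite -{1}(spectral_fun_id Dh) spectral_fun_eigvec.
have vD : v ^t* *m D = l%:C *: v ^t*.
  rewrite -[D in LHS](hermsymP D).1// -trmxC_mul Dv linearZ /= map_mxZ.
  by congr (_ *: _); exact: conjc_real.
have v0 := eigvec_neq0 D j.
have : 0 <= l%:C * ((v ^t* *m T *m v) 0 0 + (v ^t* *m S *m v) 0 0).
  have := ST v; rewrite (_ : T *m T - S *m S = T *m D + D *m S).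
    rewrite mulmxDr mulmxDl [v ^t* *m (D *m S)]mulmxA vD -[_ *m (T *m D) *m v]mulmxA.
    rewrite -[T *m D *m v]mulmxA Dv -!scalemxAr -!scalemxAl mulmxA.
    by rewrite [X in 0 <= X -> _]mxE [X in X + _]mxE [X in _ + X]mxE -mulrDr.
  by rewrite mulmxBr mulmxBl addrA subrK.
by rewrite pmulr_lge0 ?ler0c// addr_gt0 ?Tp ?Sp.
Qed.

Local Opaque spectral_funmx.

(** * Operator monotonicity of the logarithm *)

(** The [2^k]-th root, written so that its relation to [ln] is immediate: the
logarithm is the limit of [2^k (dyadic_root k x - 1)]. *)
Definition dyadic_root (k : nat) (x : R) : R := expR (ln x / 2 ^+ k).

Lemma dyadic_root_monotone k A B : posdefmx A -> posdefmx B -> psdmx (B - A) ->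
  psdmx (spectral_funmx (dyadic_root k) B - spectral_funmx (dyadic_root k) A).
Proof.
move=> Ap Bp AB; elim: k => [|k IHk].
  suff root0 (C : 'M[R[i]]_n) : posdefmx C ->
      spectral_funmx (dyadic_root 0) C = C by rewrite !root0.
  move=> Cp; rewrite -[RHS](spectral_fun_id Cp.1); apply: eq_spectral_fun => j.
  by rewrite /dyadic_root expr0 divr1 lnK// posrE posdef_spectrum.
have rootS (C : 'M[R[i]]_n) :
    spectral_funmx (dyadic_root k.+1) C *m spectral_funmx (dyadic_root k.+1) C
    = spectral_funmx (dyadic_root k) C.
  rewrite -spectral_funM; apply: eq_spectral_fun => j.
  by rewrite /dyadic_root -expRD exprS; congr expR; field; rewrite expf_neq0 ?pnatr_eq0.
apply: sqrt_monotone; last by rewrite !rootS; exact: IHk.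
- by apply: posdef_spectral_fun => j; apply: expR_gt0.
- by apply: posdef_spectral_fun => j; apply: expR_gt0.
Qed.

Lemma le_scaled_expR (L N : R) : 0 < N -> L <= N * (expR (L / N) - 1).
Proof.
move=> N0; have := expR_ge1Dx (L / N); rewrite -lerBrDl => h.
by rewrite -(ler_pM2l N0) mulrCA divff ?mulr1 ?gt_eqF// in h.
Qed.

(** A quantitative form of [N (e^(L/N) - 1) --> L]; the error [O(1/N)] is explicit
so that only the Archimedean property is needed to pass to the limit. *)
Lemma scaled_expR_le (L N : R) : 1 <= N ->
  N * (expR (L / N) - 1) <= L + L ^+ 2 * expR `|L| / N.
Proof.
move=> N1; have N0 : 0 < N by apply: lt_le_trans N1.
set t := L / N; have LE : L = N * t by rewrite /t mulrCA divff ?mulr1 ?gt_eqF.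
(* From [1 - t <= e^(-t)], multiplied by [e^t]. *)
have e1 : expR t - 1 <= t * expR t.
  have := expR_ge1Dx (- t); rewrite -(ler_pM2l (expR_gt0 t)) expRxMexpNx_1; nra.
have h : N * (expR t - 1) <= L * expR t by rewrite [in leRHS]LE -mulrA ler_pM2l.
apply: le_trans h _; rewrite -lerBlDl.
have -> : L * expR t - L = L * (expR t - 1) by ring.
have -> : L ^+ 2 * expR `|L| / N = L * (t * expR `|L|) by rewrite /t; ring.
have [L0|L0] := leP 0 L.
  apply: ler_wpM2l => //; apply: le_trans e1 _.
  have t0 : 0 <= t by rewrite divr_ge0// ltW.
  apply: ler_wpM2l => //; rewrite ler_expR ger0_norm// /t ler_pdivrMr//.
  by rewrite ler_peMr.
rewrite ler_nM2l//; have t0 : t < 0 by rewrite /t pmulr_llt0 ?invr_gt0.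
apply: (@le_trans _ _ t); last by rewrite lerBrDl expR_ge1Dx.
by rewrite ger_nMr// -expR0 ler_expR normr_ge0.
Qed.

(** The spectral measure of [A] at [v]: one set of nonnegative weights represents
all the forms [v^* f(A) v] simultaneously, which turns limits in [f] into limits
of finite sums of real numbers. *)
Lemma qform_weights A (v : 'cV[R[i]]_n) : exists p : 'I_n -> R,
  (forall j, 0 <= p j) /\
  forall f, (v ^t* *m spectral_funmx f A *m v) 0 0 =
            (\sum_j f (spectrum A 0 j) * p j)%:C.
Proof.
exists (fun j => complex.Re (`|(spectralmx A *m v) j 0| ^+ 2)).
have pE j : (complex.Re (`|(spectralmx A *m v) j 0| ^+ 2))%:C
    = `|(spectralmx A *m v) j 0| ^+ 2.
  by rewrite RRe_real// ger0_real// exprn_ge0.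
split=> [j|f]; first by rewrite -ler0c pE exprn_ge0.
rewrite qform_spectral_fun rmorph_sum; apply: eq_bigr => j _.
by rewrite rmorphM /= pE.
Qed.

(** Square roots are operator monotone, hence so are all dyadic roots, and the
logarithm is the pointwise limit of [2^k (x^(1/2^k) - 1)], approached from
above. *)
Lemma log_monotone A B : posdefmx A -> posdefmx B -> psdmx (B - A) ->
  psdmx (logmx B - logmx A).
Proof.
move=> Ap Bp AB v.
have [p [p0 pE]] := qform_weights A v; have [q [q0 qE]] := qform_weights B v.
have pq : \sum_j p j = \sum_j q j.
  apply: (@complexI R); have := pE (fun=> 1); have := qE (fun=> 1).
  by rewrite !spectral_fun_cst => ->; under eq_bigr do rewrite mul1r;
    under [in RHS]eq_bigr do rewrite mul1r.
have cmp f : (0 <= (v ^t* *m (spectral_funmx f B - spectral_funmx f A) *m v) 0 0)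
    = (\sum_j f (spectrum A 0 j) * p j <= \sum_j f (spectrum B 0 j) * q j).
  by rewrite qformB subr_ge0 [leRHS]qE [leLHS]pE lecR.
rewrite /logmx cmp.
set a := \sum_j _; set b := \sum_j _.
(* Total error of the dyadic approximation of the form of [log B]. *)
pose K := \sum_j ln (spectrum B 0 j) ^+ 2 * expR `|ln (spectrum B 0 j)| * q j.
have bound k : a <= b + K / 2 ^+ k.
  have N0 : 0 < 2 ^+ k :> R by rewrite exprn_gt0.
  have N1 : 1 <= 2 ^+ k :> R by rewrite exprn_ege1// ler1n.
  pose g x := 2 ^+ k * (dyadic_root k x - 1).
  have gsum (C : 'M[R[i]]_n) s : \sum_j g (spectrum C 0 j) * s j =
      2 ^+ k * (\sum_j dyadic_root k (spectrum C 0 j) * s j - \sum_j s j).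
    by rewrite -sumrB mulr_sumr; apply: eq_bigr => j _; rewrite /g; ring.
  apply: (@le_trans _ _ (\sum_j g (spectrum A 0 j) * p j)).
    by apply: ler_sum => j _; apply: ler_wpM2r => //; apply: le_scaled_expR.
  apply: (@le_trans _ _ (\sum_j g (spectrum B 0 j) * q j)).
    rewrite !gsum pq ler_pM2l// lerD2r.
    by have := dyadic_root_monotone k Ap Bp AB v; rewrite cmp.
  rewrite /b /K mulr_suml -big_split /=; apply: ler_sum => j _.
  apply: le_trans (ler_wpM2r (q0 j) (scaled_expR_le _ N1)) _.
  by rewrite mulrDl lerD2l mulrAC.
rewrite leNgt; apply/negP => ba.
have ab0 : 0 < a - b by rewrite subr_gt0.
have K0 : 0 <= K.
  by apply: sumr_ge0 => j _; rewrite mulr_ge0 ?q0 // mulr_ge0 ?sqr_ge0 ?expR_ge0.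
have := archi_boundP (divr_ge0 K0 (ltW ab0)); set k := Num.bound _ => kK.
have := bound k; apply/negP; rewrite -ltNge -ltrBrDl ltr_pdivrMr ?exprn_gt0//.
rewrite mulrC -ltr_pdivrMr//; apply: lt_le_trans kK _.
by rewrite -natrX ler_nat ltnW// ltn_expl.
Qed.

(** * The geometric mean as a solution of a Riccati equation *)

Lemma sqrtmx_posdef A : posdefmx A -> posdefmx (sqrtmx A).
Proof. by move=> Ap; apply: posdef_spectral_fun => j; rewrite sqrtr_gt0 posdef_spectrum. Qed.

Lemma sqrtmx_sq A : posdefmx A -> sqrtmx A *m sqrtmx A = A.
Proof.
move=> Ap; rewrite -spectral_funM -[RHS](spectral_fun_id Ap.1).
by apply: eq_spectral_fun => j; rewrite -expr2 sqr_sqrtr// ltW// posdef_spectrum.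
Qed.

Lemma posdef_inv A : posdefmx A -> posdefmx (invmx A).
Proof.
move=> Ap; suff -> : invmx A = spectral_funmx GRing.inv A.
  by apply: posdef_spectral_fun => j; rewrite invr_gt0 posdef_spectrum.
rewrite -[RHS]mul1mx -(mulVmx (posdef_unit Ap)) -mulmxA.
rewrite -{3}(spectral_fun_id Ap.1) -spectral_funM.
rewrite (@eq_spectral_fun _ (fun=> 1)) ?spectral_fun_cst ?mulmx1// => j.
by rewrite mulfV// gt_eqF// posdef_spectrum.
Qed.

Lemma geomean_posdef A B : posdefmx A -> posdefmx B -> posdefmx (geomean A B).
Proof.
move=> Ap Bp; have Sp := sqrtmx_posdef Ap; have Vp := posdef_inv Sp.
rewrite /geomean; apply: (posdef_sandwich Sp); apply: sqrtmx_posdef.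
exact: posdef_sandwich Vp Bp.
Qed.

(** With [S := A^(1/2)] and [T := (S^-1 X^-1 S^-1)^(1/2)], the geometric mean is
[S T S]; since [S X S] is the inverse of [T^2], the middle of
[S T (S X S) T S] collapses to [S S = A]. *)
Lemma geomean_riccati A X : posdefmx A -> posdefmx X ->
  geomean A (invmx X) *m X *m geomean A (invmx X) = A.
Proof.
move=> Ap Xp; have Xu := posdef_unit Xp.
move: (sqrtmx_sq Ap) (sqrtmx_posdef Ap); rewrite /geomean.
move: (sqrtmx A) => S SS Sp; have Su := posdef_unit Sp.
pose M := invmx S *m invmx X *m invmx S.
have Mp : posdefmx M by exact: posdef_sandwich (posdef_inv Sp) (posdef_inv Xp).
have MSXS : M *m (S *m X *m S) = 1%:M.
  by rewrite /M -!mulmxA (mulKmx Su) (mulKmx Xu) (mulVmx Su).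
move: (sqrtmx_sq Mp); rewrite -/M; move: (sqrtmx M) => T TT.
have TST : T *m (S *m X *m S) *m T = 1%:M by apply: mulmx1C; rewrite (mulmxA T T) TT.
have -> : A = S *m (T *m (S *m X *m S) *m T) *m S by rewrite TST mulmx1.
by rewrite !mulmxA.
Qed.

(** * Traces, determinants and sums over ordered eigenvalues *)

Lemma size_eigenvalues A : size (eigenvalues A) = n.
Proof. by rewrite size_sort size_map size_enum_ord. Qed.

Lemma eigenvaluesP A x : x \in eigenvalues A -> exists j, x = spectrum A 0 j.
Proof.
by rewrite mem_sort => /mapP[j _ ->]; exists j; rewrite mxE.
Qed.

Lemma eigenvalues_gt0 A j : posdefmx A -> (j < n)%N -> 0 < (eigenvalues A)`_j.
Proof.
move=> Ap jn; have : (eigenvalues A)`_j \in eigenvalues A by rewrite mem_nth ?size_eigenvalues.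
by move/eigenvaluesP => [i ->]; apply: posdef_spectrum.
Qed.

Lemma eigenvalues_le A i j : (i <= j < n)%N ->
  (eigenvalues A)`_j <= (eigenvalues A)`_i.
Proof.
case/andP=> ij jn.
have srt : sorted >=%O (eigenvalues A) by apply: sort_sorted => x y; apply: le_total.
have ge_tr : transitive (>=%O : rel R) by move=> x y z h1 h2; apply: le_trans h2 h1.
have [iS jS] : (i < size (eigenvalues A))%N /\ (j < size (eigenvalues A))%N.
  by rewrite size_eigenvalues (leq_ltn_trans ij jn).
exact: (sorted_leq_nth ge_tr (@lexx _ R) 0 srt i j iS jS ij).
Qed.

Lemma sum_spectrum f A : \sum_j f (spectrum A 0 j) = \sum_(j < n) f (eigenvalues A)`_j.
Proof.
transitivity (\sum_(x <- eigenvalues A) f x).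
  rewrite (perm_big _ (permEl (perm_sort _ _))) big_map big_enum /=.
  by apply: eq_bigr => j _; rewrite mxE.
by rewrite (big_nth 0) size_eigenvalues big_mkord.
Qed.

Lemma prod_eigenvalues A k : posdefmx A -> (k <= n)%N ->
  \prod_(j < k) (eigenvalues A)`_j = expR (\sum_(j < k) ln (eigenvalues A)`_j).
Proof.
move=> Ap kn; rewrite expR_sum; apply: eq_bigr => j _.
by rewrite lnK// posrE eigenvalues_gt0// (leq_trans _ kn).
Qed.

(** The sum over the top [k] eigenvectors of [A] of the form of [f(A)] is bounded
by that of [D + c]; the forms of [D] at the remaining eigenvectors are
nonnegative, so adding them completes the partial trace of [D] to [tr D]. *)
Lemma sum_eigenvalues_le f A D (c : R) k : (k <= n)%N -> psdmx D ->
  psdmx (D + c%:C%:M - spectral_funmx f A) ->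
  (\sum_(j < k) f (eigenvalues A)`_j)%:C <= \tr D + (c *+ k)%:C.
Proof.
move=> kn Dp fD.
(* [J] orders the indices of the eigenvectors by decreasing eigenvalue, so that
   [take k J] indexes the top [k] of them. *)
pose e j := spectrum A 0 j; pose J := sort (relpre e >=%O) (enum 'I_n).
have eigJ : eigenvalues A = map e J.
  rewrite -sort_map /eigenvalues; congr sort; apply: eq_map => j.
  by rewrite /e mxE.
have szJ : size J = n by rewrite size_sort size_enum_ord.
pose q j := ((eigvec A j) ^t* *m D *m eigvec A j) 0 0.
have q0 j : 0 <= q j by apply: Dp.
have le1 j : (f (e j))%:C <= q j + c%:C.
  have := fD (eigvec A j); rewrite qformB subr_ge0 [leLHS]qform_eigvec.
  by rewrite qformD -(spectral_fun_cst c A) [X in _ + X]qform_eigvec.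
have -> : \sum_(j < k) f (eigenvalues A)`_j = \sum_(j <- take k J) f (e j).
  rewrite -[RHS](big_map e predT f) map_take -eigJ (big_nth 0) big_mkord.
  rewrite size_takel ?size_eigenvalues//.
  by apply: eq_bigr => j _; rewrite nth_take.
rewrite rmorph_sum; apply: le_trans (ler_sum _ (fun j _ => le1 j)) _.
rewrite big_split /= big_const_seq count_predT size_takel ?szJ// iter_addr_0 rmorphMn lerD2r.
have -> : \tr D = \sum_(j <- J) q j.
  rewrite (trace_eigvec D A) -big_enum /=; apply/esym/perm_big.
  by rewrite perm_sort.
by rewrite -[X in _ <= \sum_(_ <- X) _](cat_take_drop k J) big_cat lerDl sumr_ge0.
Qed.

(** The trace of a logarithm is the logarithm of the determinant, which is
multiplicative. *)
Lemma trace_log_congr Y Z : posdefmx Y -> posdefmx Z ->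
  \tr (logmx (Y *m Z *m Y)) = \tr (logmx Y) *+ 2 + \tr (logmx Z).
Proof.
move=> Yp Zp.
have YZp : posdefmx (Y *m Z *m Y) by exact: posdef_sandwich.
have detE B : posdefmx B -> \det B = (expR (\sum_j ln (spectrum B 0 j)))%:C.
  move=> Bp; rewrite -{1}(spectral_fun_id Bp.1) det_spectral_fun expR_sum.
  by congr (_%:C); apply: eq_bigr => j _; rewrite lnK// posrE posdef_spectrum.
have trE B : \tr (logmx B) = (\sum_j ln (spectrum B 0 j))%:C.
  exact: trace_spectral_fun.
rewrite [LHS]trE [X in X *+ 2]trE [X in _ + X]trE.
set yz := \sum_j _; set y := \sum_j _; set z := \sum_j _.
suff -> : yz = y *+ 2 + z by rewrite rmorphD rmorphMn.
apply: expR_inj; apply: (@complexI R); rewrite -(detE _ YZp) !det_mulmx.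
rewrite (detE _ Yp) (detE _ Zp) -!rmorphM -!expRD; congr (expR _)%:C.
by rewrite mulr2n addrAC.
Qed.

(** * The majorization *)

(** Truncating a nonincreasing sequence from below at its [k]-th term
[s k.-1] keeps the first [k] terms and makes the others equal to it. *)
Lemma sum_ln_max_truncation (s : nat -> R) (N k : nat) : (0 < k <= N)%N ->
  (forall i j, (i <= j < N)%N -> s j <= s i) ->
  \sum_(j < N) ln (Num.max (s k.-1) (s j)) - ln (s k.-1) *+ N + ln (s k.-1) *+ k
  = \sum_(j < k) ln (s j).
Proof.
case/andP=> k0 kN sdec; set l := ln _.
rewrite -(big_mkord xpredT (fun j => ln (Num.max (s k.-1) (s j)))).
rewrite (big_cat_nat (leq0n k) kN)/= big_mkord.
set u := \sum_(i < k) _; set v := \sum_(_ <= _ < _) _.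
have -> : u = \sum_(j < k) ln (s j).
  apply: eq_bigr => j _; rewrite max_r// sdec// -ltnS prednK// ltn_ord/=.
  exact: leq_trans kN.
have -> : v = l *+ (N - k).
  rewrite -sumr_const_nat; apply: eq_big_nat => j /andP[kj jN].
  by rewrite max_l// sdec// jN andbT (leq_trans (leq_pred k)).
rewrite mulrnBr//; lra.
Qed.

(** The truncation argument: replacing [X] by [X' := max (X, r)] makes the
increments [D i] of the logarithms positive semidefinite, while [ln det X'] only sees the
first [k] eigenvalues of [X] above the level [r]. *)
Lemma log_weighted_majorization m (w : 'I_m -> R) (A Y : 'I_m -> 'M[R[i]]_n) X k :
  (forall i, 0 <= w i) -> \sum_i w i = 1 -> posdefmx X ->
  (forall i, posdefmx (Y i)) -> (forall i, Y i *m X *m Y i = A i) ->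
  \sum_i (w i)%:C *: logmx (Y i) = 0 -> (1 <= k <= n)%N ->
  forall E, logmx E = \sum_i (w i)%:C *: logmx (A i) ->
  \sum_(j < k) ln (eigenvalues E)`_j <= \sum_(j < k) ln (eigenvalues X)`_j.
Proof.
move=> w0 w1 Xp Yp AE Y0 /andP[k0 kn] E EE.
have wC : \sum_i (w i)%:C = 1 :> R[i] by rewrite -rmorph_sum w1.
set r := (eigenvalues X)`_k.-1.
have r0 : 0 < r by rewrite eigenvalues_gt0// prednK.
have [X' X'E] : exists X', X' = spectral_funmx (Num.max r) X by eexists.
have X'p : posdefmx X' by rewrite X'E; apply: posdef_spectral_fun => j; rewrite lt_max r0.
have XX' : psdmx (X' - X).
  rewrite X'E -{2}(spectral_fun_id Xp.1) -spectral_funB; apply: psd_spectral_fun => j.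
  by rewrite subr_ge0 le_max lexx orbT.
have rX' : psdmx (X' - r%:C%:M).
  rewrite X'E -(spectral_fun_cst r X) -spectral_funB; apply: psd_spectral_fun => j.
  by rewrite subr_ge0 le_max lexx.
pose B i := Y i *m X' *m Y i.
have AB i : psdmx (logmx (B i) - logmx (A i)).
  rewrite -AE.
  apply: (log_monotone (posdef_sandwich (Yp i) Xp) (posdef_sandwich (Yp i) X'p)).
  exact: psd_sandwichB (Yp i) XX'.
have rY2 i : r%:C *: (Y i *m Y i) = spectral_funmx (fun t => r * (t * t)) (Y i).
  by rewrite spectral_funZ spectral_funM spectral_fun_id// (Yp i).1.
have log_rY2 i : logmx (r%:C *: (Y i *m Y i)) =
    (ln r)%:C%:M + (logmx (Y i) + logmx (Y i)).
  rewrite rY2; apply: etrans (spectral_fun_comp _ _ _) _.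
  rewrite -(spectral_fun_cst _ (Y i)) -[X in _ = _ + X]spectral_funD -[RHS]spectral_funD.
  apply: eq_spectral_fun => j /=; have y0 := posdef_spectrum (Yp i) j.
  by rewrite !lnM ?posrE ?mulr_gt0.
pose D i := logmx (B i) - logmx (r%:C *: (Y i *m Y i)).
have Dp i : psdmx (D i).
  apply: log_monotone (posdef_sandwich (Yp i) X'p) _.
    rewrite rY2; apply: posdef_spectral_fun => j.
    by have y0 := posdef_spectrum (Yp i) j; apply: mulr_gt0 r0 (mulr_gt0 y0 y0).
  rewrite (_ : _ *: _ = Y i *m r%:C%:M *m Y i).
    exact: psd_sandwichB (Yp i) rX'.
  by rewrite mul_mx_scalar scalemxAl.
have sumDp : psdmx (\sum_i (w i)%:C *: D i) by apply: psd_sum => i; exact: psdZ (w0 i) (Dp i).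
have trX' : \tr (logmx X') = (\sum_(j < n) ln (Num.max r (eigenvalues X)`_j))%:C.
  rewrite X'E /logmx spectral_fun_comp [LHS]trace_spectral_fun.
  by rewrite -(sum_spectrum (@ln R \o Num.max r)).
have trD : \tr (\sum_i (w i)%:C *: D i) =
    (\sum_(j < n) ln (Num.max r (eigenvalues X)`_j) - ln r *+ n)%:C.
  rewrite raddf_sum -[RHS]mul1r -wC mulr_suml; apply: eq_bigr => i _ /=.
  rewrite mxtraceZ; congr (_ * _).
  have trB : \tr (logmx (B i)) = \tr (logmx (Y i)) *+ 2 +
      (\sum_(j < n) ln (Num.max r (eigenvalues X)`_j))%:C.
    by rewrite -trX'; exact: trace_log_congr (Yp i) X'p.
  have trY2 : \tr (logmx (r%:C *: (Y i *m Y i))) =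
      (ln r)%:C *+ n + \tr (logmx (Y i)) *+ 2.
    by rewrite log_rY2 !mxtraceD mxtrace_scalar mulr2n.
  rewrite (raddfB (@mxtrace _ n)); apply: etrans (congr2 (fun a b => a - b) trB trY2) _.
  by rewrite rmorphB rmorphMn /= [X in X - _]addrC [X in _ - X]addrC addrKA.
(* The terms [2 log (Y i)] average to zero, which leaves [sum_i w_i log (B i)]. *)
have HD : psdmx (\sum_i (w i)%:C *: D i + (ln r)%:C%:M - logmx E).
  rewrite EE; have -> : \sum_i (w i)%:C *: D i + (ln r)%:C%:M =
      \sum_i (w i)%:C *: logmx (B i).
    rewrite /D; under eq_bigr do rewrite log_rY2 scalerBr scalerDr.
    rewrite sumrB big_split /= -scaler_suml wC scale1r.
    have -> : \sum_i (w i)%:C *: (logmx (Y i) + logmx (Y i)) = 0.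
      by under eq_bigr do rewrite scalerDr; rewrite big_split /= Y0 addr0.
    by rewrite addr0; apply: subrK.
  rewrite -sumrB; apply: psd_sum => i; rewrite -scalerBr; exact: psdZ (w0 i) (AB i).
have := sum_eigenvalues_le kn sumDp HD.
rewrite trD -rmorphD lecR => /le_trans; apply.
rewrite sum_ln_max_truncation ?k0// => i j; exact: eigenvalues_le.
Qed.

Lemma trace_weighted_log m (w : 'I_m -> R) (A Y : 'I_m -> 'M[R[i]]_n) X :
  \sum_i w i = 1 -> posdefmx X ->
  (forall i, posdefmx (Y i)) -> (forall i, Y i *m X *m Y i = A i) ->
  \sum_i (w i)%:C *: logmx (Y i) = 0 ->
  \tr (\sum_i (w i)%:C *: logmx (A i)) = \tr (logmx X).
Proof.
move=> w1 Xp Yp AE Y0.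
transitivity (\sum_i (w i)%:C * (\tr (logmx (Y i)) *+ 2 + \tr (logmx X))).
  rewrite raddf_sum; apply: eq_bigr => i _; rewrite [LHS]mxtraceZ -AE.
  by congr (_ * _); exact: trace_log_congr (Yp i) Xp.
have trY0 : \sum_i (w i)%:C * \tr (logmx (Y i)) = 0.
  have := congr1 (@mxtrace _ n) Y0; rewrite mxtrace0 raddf_sum; apply: etrans.
  by apply: eq_bigr => i _; rewrite [RHS]mxtraceZ.
have -> : \sum_i (w i)%:C * (\tr (logmx (Y i)) *+ 2 + \tr (logmx X)) =
    (\sum_i (w i)%:C * \tr (logmx (Y i))) *+ 2 + (\sum_i (w i)%:C) * \tr (logmx X).
  rewrite mulr_suml -sumrMnl -big_split.
  by apply: eq_bigr => i _; rewrite mulrDr mulrnAr.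
by rewrite trY0 mul0rn add0r -rmorph_sum w1 mul1r.
Qed.

(** For [0 < n] the identity matrix differs from the default value [0] of
[karcher_mean], so the membership in [Gamma] does yield the Karcher equation at
the identity. *)
Lemma Gamma_riccati m (w : 'I_m -> R) (A : 'I_m -> 'M[R[i]]_n) X : (0 < n)%N ->
  (forall i, posdefmx (A i)) -> Gamma w A X ->
  exists Y : 'I_m -> 'M[R[i]]_n,
    [/\ forall i, posdefmx (Y i), forall i, Y i *m X *m Y i = A i
      & \sum_i (w i)%:C *: logmx (Y i) = 0].
Proof.
move=> n0 Ap [Xp kY].
have [Y YE] : exists Y : 'I_m -> 'M_n, Y = fun i => geomean (A i) (invmx X) by eexists.
exists Y; split.
- by move=> i; rewrite YE; exact: geomean_posdef (Ap i) (posdef_inv Xp).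
- by move=> i; rewrite YE; exact: geomean_riccati (Ap i) Xp.
rewrite -YE in kY.
have one_neq0 : 1%:M != 0 :> 'M[R[i]]_n.
  apply/eqP => /matrixP/(_ (Ordinal n0) (Ordinal n0)); rewrite !mxE eqxx => /eqP.
  by rewrite oner_eq0.
have kY1 : karcher_eq w Y 1%:M.
  move: kY; rewrite /karcher_mean; case: xgetP => [Z -> [_ ZY] <-//|_ /eqP].
  by rewrite eq_sym (negPf one_neq0).
have sqrt1 : sqrtmx 1%:M = 1%:M :> 'M[R[i]]_n.
  rewrite -(spectral_fun_cst 1 1%:M); apply: etrans (spectral_fun_comp _ _ _) _.
  by apply: eq_spectral_fun => j /=; rewrite sqrtr1.
rewrite -[RHS]kY1; apply: eq_bigr => i _; congr (_ *: logmx _).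
by rewrite sqrt1 invmx1 mul1mx mulmx1.
Qed.

End SpectralCalculus.

Theorem theorem3p6 (R : realType) (n m : nat)
    (A : 'I_m -> 'M[R[i]]_n) (w : 'I_m -> R)
    (A_posdef : forall i, posdefmx (A i))
    (w_gt0 : forall i, 0 < w i) (w_sum1 : \sum_(i < m) w i = 1)
    (X : 'M[R[i]]_n) (XGamma : Gamma w A X) :
  log_majorized (expmx (\sum_(i < m) (w i)%:C *: logmx (A i))) X.
Proof.
have [n0|n0] := posnP n.
  subst n; split; last by rewrite !big_ord0.
  by move=> k; rewrite leqn0 => /andP[/lt0n_neq0/negPf ->].
have [Y [Yp YXY Y0]] := Gamma_riccati n0 A_posdef XGamma; case: XGamma => Xp _.
set H := \sum_i _; have Hh : H \is hermsymmx.
  apply/hermsymP; rewrite /H raddf_sum /= map_mx_sum; apply: eq_bigr => i _.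
  rewrite linearZ /= map_mxZ (hermsymP _).1 ?spectral_fun_herm//.
  by congr (_ *: _); exact: conjc_real.
have Ep : posdefmx (expmx H) by apply: posdef_spectral_fun => j; apply: expR_gt0.
have logE : logmx (expmx H) = H.
  rewrite /logmx /expmx spectral_fun_comp -[RHS](spectral_fun_id Hh).
  by apply: eq_spectral_fun => j /=; rewrite expRK.
split=> [k kn|].
  have [_ kn'] := andP kn; rewrite (prod_eigenvalues Ep kn') (prod_eigenvalues Xp kn').
  have w_ge0 i : 0 <= w i by apply: ltW.
  by rewrite ler_expR (log_weighted_majorization w_ge0 w_sum1 Xp Yp YXY Y0 kn logE).
rewrite (prod_eigenvalues Ep (leqnn n)) (prod_eigenvalues Xp (leqnn n)).
congr expR; apply: (@complexI R).
rewrite -(sum_spectrum (@ln R) (expmx H)) -(sum_spectrum (@ln R) X).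
apply: etrans (esym (trace_spectral_fun (@ln R) (expmx H))) _.
apply: etrans (trace_spectral_fun (@ln R) X).
by rewrite [spectral_funmx _ (expmx H)]logE; exact: trace_weighted_log w_sum1 Xp Yp YXY Y0.
Qed.
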